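(* Let $F$ be an absolute, normalised norm on $\mathbb{R}^2$ and let $X$ and $Y$ be nontrivial real Banach spaces such that $X\oplus_F Y$ is LOH. Then for every $x\in S_X$ and every $\varepsilon>0$ there is a $z\in S_X$ such that $\|x+z\|\geq 2r_F-\varepsilon$ and $\|x-z\|\geq 2r_F-\varepsilon$.
   Context: All Banach spaces are real; nontrivial means $\neq\{0\}$. $S_X$ is the unit sphere of $X$. A norm $F$ on $\mathbb{R}^2$ is absolute if $F(a,b)=F(|a|,|b|)$ for all $(a,b)\in\mathbb{R}^2$, and normalised if $F(1,0)=F(0,1)=1$. For such an absolute, normalised norm $F$ and Banach spaces $X,Y$, the absolute sum $X\oplus_F Y$ is $X\times Y$ with the norm $\|(x,y)\|_F=F(\|x\|,\|y\|)$ (it is a Banach space). For an absolute, normalised norm $F$ on $\mathbb{R}^2$ set $$r_F:=\inf\{a\in[0,1]:\ \exists\, b\geq 0 \text{ with } F(a,b)=1 \text{ and } F(a+1,b)=2\}.$$ A Banach space $X$ is locally octahedral (LOH) if for every $x\in X$ and every $\varepsilon>0$ there exists $y\in S_X$ such that $\|sx+y\|\geq(1-\varepsilon)(|s|\,\|x\|+1)$ for all $s\in\mathbb{R}$. *)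

(* Defs.v *)
From HB Require Import structures.
From mathcomp Require Import all_boot all_order all_algebra.
From mathcomp Require Import all_classical all_reals all_analysis.
From mathcomp Require Import ring lra.
Set Implicit Arguments.
Unset Strict Implicit.
Unset Printing Implicit Defensive.
Import Order.TTheory GRing.Theory Num.Theory.
Import numFieldNormedType.Exports.
Local Open Scope classical_set_scope.
Local Open Scope ring_scope.

(* Nonnegativity of F is omitted because it follows from the triangle
   inequality and homogeneity, as in the factory Lmodule_isNormed. *)
Record absNorm (R : realType) := AbsNorm {
  absnorm_fun :> R -> R -> R;
  absnormD : forall a b c d,
    absnorm_fun (a + c) (b + d) <= absnorm_fun a b + absnorm_fun c d;
  absnormZ : forall k a b,
    absnorm_fun (k * a) (k * b) = `|k| * absnorm_fun a b;
  absnorm_eq0 : forall a b, absnorm_fun a b = 0 -> a = 0 /\ b = 0;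
  absnorm_abs : forall a b, absnorm_fun a b = absnorm_fun `|a| `|b|;
  absnorm10 : absnorm_fun 1 0 = 1;
  absnorm01 : absnorm_fun 0 1 = 1
}.

Definition rF (R : realType) (F : absNorm R) : R :=
  inf [set a | 0 <= a <= 1 /\
    exists b, [/\ 0 <= b, F a b = 1 & F (a + 1) b = 2]].

Section absNorm_theory.
Context {R : realType} (F : absNorm R).
Implicit Types a b c d : R.

Lemma absnormC0 a : F a 0 = `|a|.
Proof. by have := absnormZ F a 1 0; rewrite mulr1 mulr0 absnorm10 mulr1. Qed.

Lemma absnorm0C b : F 0 b = `|b|.
Proof. by have := absnormZ F b 0 1; rewrite mulr1 mulr0 absnorm01 mulr1. Qed.

Lemma absnormNl a b : F (- a) b = F a b.
Proof. by rewrite absnorm_abs normrN -absnorm_abs. Qed.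

Lemma absnormNr a b : F a (- b) = F a b.
Proof. by rewrite absnorm_abs normrN -absnorm_abs. Qed.

Lemma absnorm_le_add a b : F a b <= `|a| + `|b|.
Proof.
by have := absnormD F a 0 0 b; rewrite addr0 add0r absnormC0 absnorm0C.
Qed.

Lemma absnorm_monol a c b : 0 <= a -> a <= c -> F a b <= F c b.
Proof.
move=> a0 ac; have [c0|c0] := leP c 0.
  by have -> : a = c by apply/eqP; rewrite eq_le ac (le_trans c0).
pose t := (a / c + 1) / 2.
have a1 : a / c <= 1 by rewrite ler_pdivrMr ?mul1r.
have a2 : 0 <= a / c by rewrite divr_ge0 // ltW.
have Ea : a = t * c + (1 - t) * (- c) by rewrite /t; field; rewrite gt_eqF.
have Eb : b = t * b + (1 - t) * b by ring.
have t0 : 0 <= t by rewrite /t; lra.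
have t1 : 0 <= 1 - t by rewrite /t; lra.
rewrite [in leLHS]Ea [in leLHS]Eb.
apply: (le_trans (absnormD _ _ _ _ _)).
by rewrite !absnormZ absnormNl !ger0_norm // -mulrDl subrKC mul1r.
Qed.

Lemma absnorm_monor a b d : 0 <= b -> b <= d -> F a b <= F a d.
Proof.
move=> b0 bd; have [d0|d0] := leP d 0.
  by have -> : b = d by apply/eqP; rewrite eq_le bd (le_trans d0).
pose t := (b / d + 1) / 2.
have a1 : b / d <= 1 by rewrite ler_pdivrMr ?mul1r.
have a2 : 0 <= b / d by rewrite divr_ge0 // ltW.
have Eb : b = t * d + (1 - t) * (- d) by rewrite /t; field; rewrite gt_eqF.
have Ea : a = t * a + (1 - t) * a by ring.
have t0 : 0 <= t by rewrite /t; lra.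
have t1 : 0 <= 1 - t by rewrite /t; lra.
rewrite [in leLHS]Ea [in leLHS]Eb.
apply: (le_trans (absnormD _ _ _ _ _)).
by rewrite !absnormZ absnormNr !ger0_norm // -mulrDl subrKC mul1r.
Qed.

Lemma absnorm_mono a b c d :
  0 <= a -> 0 <= b -> a <= c -> b <= d -> F a b <= F c d.
Proof.
move=> a0 b0 ac bd.
by rewrite (le_trans (absnorm_monol b a0 ac)) // absnorm_monor.
Qed.

Lemma absnorm_gel a b : `|a| <= F a b.
Proof.
by rewrite -absnormC0 [leRHS]absnorm_abs [leLHS]absnorm_abs normr0 absnorm_monor.
Qed.

Lemma absnorm_ger a b : `|b| <= F a b.
Proof.
by rewrite -absnorm0C [leRHS]absnorm_abs [leLHS]absnorm_abs normr0 absnorm_monol.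
Qed.

End absNorm_theory.

(* The alias hides the canonical max norm of X * Y. *)
Definition absSum (R : realType) (F : absNorm R) (X Y : normedModType R) : Type :=
  (X * Y)%type.

Section absSum_normed.
Context {R : realType} (F : absNorm R) (X Y : normedModType R).
Local Notation S := (absSum F X Y).

HB.instance Definition _ := GRing.Lmodule.copy S (X * Y)%type.

Definition absSum_norm (u : S) : R := F `|u.1| `|u.2|.

Lemma absSum_normD (u v : S) :
  absSum_norm (u + v) <= absSum_norm u + absSum_norm v.
Proof.
apply: le_trans (absnormD F _ _ _ _).
by apply: absnorm_mono => //; exact: ler_normD.
Qed.

Lemma absSum_normZ (k : R) (u : S) : absSum_norm (k *: u) = `|k| * absSum_norm u.
Proof. by rewrite /absSum_norm /= !normrZ absnormZ normr_id. Qed.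

Lemma absSum_norm_eq0 (u : S) : absSum_norm u = 0 -> u = 0.
Proof. by case: u => x y /absnorm_eq0[/= /normr0_eq0-> /normr0_eq0->]. Qed.

HB.instance Definition _ := Lmodule_isNormed.Build R S
  absSum_normD absSum_normZ absSum_norm_eq0.

Lemma absSum_normE (u : S) : `|u| = F `|u.1| `|u.2|.
Proof. by []. Qed.

End absSum_normed.

Section absSum_complete.
Context {R : realType} (F : absNorm R) (X Y : completeNormedModType R).
Local Notation S := (absSum F X Y).

Lemma absSum_cauchy_cvg (G : set_system S) :
  ProperFilter G -> cauchy G -> cvg G.
Proof.
move=> GG /cauchy_ballP Gc.
pose p1 (u : S) : X := u.1; pose p2 (u : S) : Y := u.2.
have /cauchy_cvg /cvg_ex[x xP] : cauchy (p1 @ G).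
  apply/cauchy_ballP => e e0; rewrite near_simpl /=.
  have := Gc e e0.
  rewrite !near_map2 => H.
  apply: filterS H => -[u v]; rewrite -!ball_normE /= => uv.
  exact: le_lt_trans (le_trans (ler_norm _) (absnorm_gel F _ _)) uv.
have /cauchy_cvg /cvg_ex[y yP] : cauchy (p2 @ G).
  apply/cauchy_ballP => e e0; rewrite near_simpl /=.
  have := Gc e e0.
  rewrite !near_map2 => H.
  apply: filterS H => -[u v]; rewrite -!ball_normE /= => uv.
  exact: le_lt_trans (le_trans (ler_norm _) (absnorm_ger F _ _)) uv.
apply/cvg_ex; exists ((x, y) : S).
apply/cvgrPdist_lt => /= e e0.
have e2 : 0 < e / 2 by rewrite divr_gt0.
move/cvgrPdist_lt : xP => /(_ _ e2) xP.
move/cvgrPdist_lt : yP => /(_ _ e2) yP.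
near=> u.
rewrite absSum_normE (le_lt_trans (absnorm_le_add _ _ _)) // !normr_id.
rewrite [ltRHS](splitr e) ltrD //=; [near: u; exact: xP|near: u; exact: yP].
Unshelve. all: by end_near. Qed.

HB.instance Definition _ := Uniform_isComplete.Build S absSum_cauchy_cvg.

End absSum_complete.

Definition unit_sphere (R : realType) (X : normedModType R) : set X :=
  [set x | `|x| = 1].
Arguments unit_sphere {R} X.

Definition LOH (R : realType) (X : completeNormedModType R) : Prop :=
  forall (x : X) (eps : R), 0 < eps ->
    exists2 y, unit_sphere X y &
      forall s : R, (1 - eps) * (`|s| * `|x| + 1) <= `|s *: x + y|.

(* Main.v *)
Require Import Defs.
From HB Require Import structures.
From mathcomp Require Import all_boot all_order all_algebra.
From mathcomp Require Import all_classical all_reals all_analysis.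
From mathcomp Require Import lra.
Import Order.TTheory GRing.Theory Num.Theory.
Import numFieldNormedType.Exports.
Local Open Scope classical_set_scope.
Local Open Scope ring_scope.

(** The value [F 1 1], which is at most [2], decides between two cases.

    If [F 1 1 = 2], then [a = 0] is admissible in the infimum (with [b = 1]),
    so [rF F <= 0] and any [z] on the sphere works ([rF_le0]).

    If [F 1 1 < 2], even [2 - eps] can be reached ([exists_far_unit]), which is
    enough because [a = 1], [b = 0] is admissible and hence [rF F <= 1].
    Local octahedrality of the sum at [(x, 0)] gives a unit vector [(u, v)] with
    [F `|s *: x + u| `|v| >= (1 - d) * (`|s| + 1)] for all [s].  The scale
    [s = 1] shows that [u] is not small, since [F 1 `|v| <= F 1 1] stays away
    from [2].  At the scale [s = `|u|], moving the first coordinate from [`|u|]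
    to [`|s *: x + u|] raises [F] from [1] to almost [1 + `|u|]; as [F] is
    1-Lipschitz in that coordinate, [`|s *: x + u|] is at least nearly
    [2 * `|u|] ([absnorm_fst_ge]).  Dividing by [`|u|] makes [`|x + z|] nearly
    [2] for [z = u / `|u|], and [s = - `|u|] does the same for [`|x - z|]. *)

Section AbsoluteNorms.
Context {R : realType} (F : absNorm R).
Implicit Types a b c d : R.

Lemma absnorm_lip_fst a b c : F (a + c) b <= F a b + `|c|.
Proof. by have := absnormD F a b c 0; rewrite addr0 absnormC0. Qed.

Lemma rF_le a b :
  0 <= a <= 1 -> 0 <= b -> F a b = 1 -> F (a + 1) b = 2 -> rF F <= a.
Proof.
move=> a01 b0 Fab Fa1b; apply: ge_inf; first by exists 0 => t [] /andP[].
by split=> //; exists b.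
Qed.

Lemma rF_le1 : rF F <= 1.
Proof.
by apply: (@rF_le 1 0); rewrite ?absnormC0 ?normr1 ?ler01 ?lexx // ger0_norm.
Qed.

Lemma rF_le0 : F 1 1 = 2 -> rF F <= 0.
Proof.
by move=> F11; apply: (@rF_le 0 1); rewrite ?add0r ?absnorm0C ?normr1 ?lexx ?ler01.
Qed.

(** The bound [d * (1 + a) < a] makes [F c b] exceed [1 = F a b], which by
    monotonicity rules out [c < a]; the Lipschitz bound then applies with the
    increment [c - a]. *)
Lemma absnorm_fst_ge a b c d : 0 <= c -> F a b = 1 -> d * (1 + a) < a ->
  (1 - d) * (a + 1) <= F c b -> 2 * a - d * (1 + a) <= c.
Proof.
move=> c0 Fab da Fcb; have [ac|ca] := leP a c.
  have := absnorm_lip_fst a b (c - a).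
  by rewrite subrKC Fab ger0_norm ?subr_ge0 //; lra.
by have := absnorm_monol F b c0 (ltW ca); rewrite Fab; lra.
Qed.

End AbsoluteNorms.

(** The hypothesis [F 1 1 < 2] keeps the first component of the LOH witness
    away from [0], so that normalising it does not amplify the error.  When
    [F 1 1 = 2], as for the norm [`|a| + `|b|], the witness may lie
    entirely in [Y] and say nothing about [X]. *)
Lemma exists_far_unit (R : realType) (F : absNorm R)
    (X Y : completeNormedModType R) (x : X) (eps : R) :
  LOH (absSum F X Y) -> `|x| = 1 -> F 1 1 < 2 -> 0 < eps ->
  exists z : X, [/\ `|z| = 1, 2 - eps <= `|x + z| & 2 - eps <= `|x - z|].
Proof.
move=> loh x1 F11 eps0.
pose k := 2 - F 1 1; have k0 : 0 < k by rewrite subr_gt0.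
(* [d <= k / 8] forces [`|u| >= k / 2] and the smallness condition of
   [absnorm_fst_ge]; the error [d * (1 + `|u|) / `|u|] is then at most
   [4 * d / k <= eps]. *)
pose d := Num.min (k / 8) (k * eps / 8).
have d0 : 0 < d by rewrite lt_min !divr_gt0 ?mulr_gt0.
have dk : d <= k / 8 by rewrite ge_min lexx.
have dke : d <= k * eps / 8 by rewrite ge_min lexx orbT.
have [[u v] uv1 H] := loh ((x, 0) : absSum F X Y) d d0.
have Fuv : F `|u| `|v| = 1 by exact: uv1.
have {}H s : (1 - d) * (`|s| + 1) <= F `|s *: x + u| `|v|.
  have := H s; rewrite !absSum_normE /=.
  by rewrite scaler0 add0r normr0 absnormC0 x1 normr1 mulr1.
have u_le1 : `|u| <= 1 by have := absnorm_gel F `|u| `|v|; rewrite Fuv normr_id.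
have v_le1 : `|v| <= 1 by have := absnorm_ger F `|u| `|v|; rewrite Fuv normr_id.
have u_ge : k / 2 <= `|u|.
  have xu : `|x + u| <= 1 + `|u| by rewrite -x1 ler_normD.
  have := H 1; rewrite normr1 scale1r => H1.
  have := absnorm_monol F `|v| (normr_ge0 _) xu.
  have := absnorm_lip_fst F 1 `|v| `|u|.
  have := absnorm_monor F 1 (normr_ge0 _) v_le1.
  rewrite normr_id; move: dk; rewrite /k; lra.
have u0 : 0 < `|u| by lra.
have du : d * (1 + `|u|) <= 2 * d by nra.
have far s : `|s| = `|u| -> (2 - eps) * `|u| <= `|s *: x + u|.
  move=> su; have := H s; rewrite su => Hs.
  have := absnorm_fst_ge F _ _ _ d (normr_ge0 _) Fuv _ Hs.
  have du' : d * (1 + `|u|) < `|u| by lra.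
  by move=> /(_ du'); nra.
exists (`|u|^-1 *: u); split.
- by rewrite normrZ normfV normr_id mulVf ?gt_eqF.
- rewrite -(ler_pM2r u0) (le_trans (far `|u| _)) ?normr_id //.
  rewrite -[X in _ * X](normr_id u) mulrC -normrZ scalerDr scalerA.
  by rewrite mulfV ?gt_eqF // scale1r.
- rewrite -(ler_pM2r u0) (le_trans (far (- `|u|) _)) ?normrN ?normr_id //.
  rewrite -[X in _ * X](normr_id u) mulrC -normrZ scalerBr scalerA.
  by rewrite mulfV ?gt_eqF // scale1r scaleNr -normrN opprD opprK.
Qed.

Theorem proposition2p7 (R : realType) (F : absNorm R)
    (X Y : completeNormedModType R)
    (X_nontrivial : exists x : X, x != 0)
    (Y_nontrivial : exists y : Y, y != 0)
    (XY_LOH : LOH (absSum F X Y))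
    (x : X) (x_unit : unit_sphere X x) (eps : R) (eps_gt0 : 0 < eps) :
  exists z : X, [/\ unit_sphere X z,
    2 * rF F - eps <= `|x + z| & 2 * rF F - eps <= `|x - z| ].
Proof.
have [F11|F11] := ltP (F 1 1) 2.
  have [z [z1 xpz xmz]] := exists_far_unit R F X Y x eps XY_LOH x_unit F11 eps_gt0.
  have r1 := rF_le1 F.
  by exists z; split=> //; [apply: le_trans xpz | apply: le_trans xmz]; lra.
have F11E : F 1 1 = 2.
  by apply/eqP; rewrite eq_le F11 (le_trans (absnorm_le_add _ _ _)) // normr1.
have r0 := rF_le0 F F11E.
by exists x; split=> //; apply: le_trans (normr_ge0 _); lra.
Qed.
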